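(* Let $\mathbb{P}=\prod_{i=1}^k\mathbb{P}(V_i)$ and $Q=\prod_{i=1}^kQ_i\subset\mathbb{P}$. The spectral variety \[ \Sigma_{\mathbf{n},\boldsymbol{\omega}}=\{([T],[\mathbf{x}_1],\ldots,[\mathbf{x}_k])\in\mathbb{P}(S^{\boldsymbol{\omega}}V)\times\mathbb{P}\mid([\mathbf{x}_1],\ldots,[\mathbf{x}_k])\text{ is a singular vector }k\text{-tuple of }T\} \] is irreducible, and $\Sigma_{\mathbf{n},\boldsymbol{\omega}}=\overline{\beta^{-1}(\mathbb{P}\setminus Q)}$, where $\beta\colon\Sigma_{\mathbf{n},\boldsymbol{\omega}}\to\mathbb{P}$ is the projection.
   Context: Let $k\ge 1$. For $i\in\{1,\ldots,k\}$, $V_i$ is a complex vector space of dimension $n_i\geq 1$, with $\mathbf{n}=(n_1,\ldots,n_k)$, and $\boldsymbol{\omega}=(\omega_1,\ldots,\omega_k)$ is a vector of positive integers. $S^{\boldsymbol{\omega}}V:=\bigotimes_{i=1}^k S^{\omega_i}V_i$. On each $V_i$ fix a quadratic form $q_i$, the complexification of a positive definite real quadratic form on a real form of $V_i$; write also $q_i(\cdot,\cdot)$ for the associated complex symmetric bilinear form, and $Q_i=\{q_i=0\}\subset\mathbb{P}(V_i)$ for the isotropic quadric. The Frobenius inner product $q_F$ on $S^{\boldsymbol{\omega}}V$ is the symmetric bilinear form determined by $q_F(\mathbf{x}_1^{\omega_1}\otimes\cdots\otimes\mathbf{x}_k^{\omega_k},\mathbf{y}_1^{\omega_1}\otimes\cdots\otimes\mathbf{y}_k^{\omega_k})=\prod_i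 q_i(\mathbf{x}_i,\mathbf{y}_i)^{\omega_i}$. For $T\in S^{\boldsymbol{\omega}}V$ and nonzero $\mathbf{x}_j\in V_j$, the contraction $T(\mathbf{x}_1^{\omega_1}\otimes\cdots\otimes\mathbf{x}_i^{\omega_i-1}\otimes\cdots\otimes\mathbf{x}_k^{\omega_k})\in V_i$ is the vector $\mathbf{v}$ such that $q_i(\mathbf{v},\mathbf{y})=q_F(T,\mathbf{x}_1^{\omega_1}\otimes\cdots\otimes\mathbf{x}_i^{\omega_i-1}\cdot\mathbf{y}\otimes\cdots\otimes\mathbf{x}_k^{\omega_k})$ for all $\mathbf{y}\in V_i$. A singular vector $k$-tuple of $T$ is a tuple $([\mathbf{x}_1],\ldots,[\mathbf{x}_k])\in\mathbb{P}$ such that for every $i$ the vectors $T(\mathbf{x}_1^{\omega_1}\otimes\cdots\otimes\mathbf{x}_i^{\omega_i-1}\otimes\cdots\otimes\mathbf{x}_k^{\omega_k})$ and $\mathbf{x}_i$ are linearly dependent. Closures and irreducibility are with respect to the Zariski topology. *)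

(* Defs.v *)
(* The field of complex numbers is R[i], for R : realType. *)
From HB Require Import structures.
From mathcomp Require Import all_boot all_fingroup all_order all_algebra.
From mathcomp Require Import sesquilinear complex.
From mathcomp Require Import boolp classical_sets reals topology.

Set Implicit Arguments.
Unset Strict Implicit.
Unset Printing Implicit Defensive.
Import Order.TTheory GRing.Theory Num.Theory.
Local Open Scope classical_set_scope.
Local Open Scope ring_scope.

Definition projective (F : fieldType) (V : vectType F) : Type :=
  {L : {vspace V} | \dim L == 1%N}.

Section Zariski.
Context {F : numFieldType} {I : finType}.
Implicit Type W : I -> vectType F.

Definition multiproj W : Type := forall j, projective (W j).

(* [coords p x] : p is the point ([x_j])_j; this forces every x_j to be
   nonzero, since p j has dimension 1. *)
Definition coords W (p : multiproj W) (x : forall j, W j) : Prop :=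
  forall j, (val (p j) = <[x j]>)%VS.

(* The coordinate ring of the affine space prod_j W_j, realised as functions:
   the algebra generated by the linear forms on the factors.  F is infinite,
   so polynomials and polynomial functions are the same thing. *)
Inductive polyfun W : ((forall j, W j) -> F) -> Prop :=
| polyfun_cst (c : F) : polyfun (fun _ => c)
| polyfun_lin (j : I) (l : {scalar W j}) : polyfun (fun x => l (x j))
| polyfun_add f g : polyfun f -> polyfun g -> polyfun (fun x => f x + g x)
| polyfun_mul f g : polyfun f -> polyfun g -> polyfun (fun x => f x * g x).

Definition multihomogeneous W (f : (forall j, W j) -> F) : Prop :=
  exists d : I -> nat, forall (c : I -> F) (x : forall j, W j),
    f (fun j => c j *: x j) = (\prod_j c j ^+ d j) * f x.

Definition zero_locus W (E : set ((forall j, W j) -> F)) : set (multiproj W) :=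
  [set p | forall f, E f -> forall x, coords p x -> f x = 0].

Definition algebraic_set W (Z : set (multiproj W)) : Prop :=
  exists2 E : set ((forall j, W j) -> F),
    (forall f, E f -> polyfun f /\ multihomogeneous f) & Z = zero_locus E.

Definition zariski_open W (U : set (multiproj W)) : Prop := algebraic_set (~` U).

Lemma coords_exist W (p : multiproj W) : exists x, coords p x.
Proof.
exists (fun j => vpick (val (p j))) => j.
have d1 : \dim (val (p j)) = 1%N by apply/eqP; exact: (valP (p j)).
apply/eqP; rewrite eq_sym eqEdim -memvE memv_pick d1 dim_vline vpick0.
by rewrite -dimv_eq0 d1.
Qed.

Lemma coords_scale W (p : multiproj W) x y : coords p x -> coords p y ->
  exists c : I -> F, y = fun j => c j *: x j.
Proof.
move=> px py; have h j : exists c, y j = c *: x j.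
  by apply/vlineP; rewrite -px py memv_line.
by have [c hc] := choice h; exists c; apply: functional_extensionality_dep.
Qed.

Lemma zariski_openT W : zariski_open (@setT (multiproj W)).
Proof.
exists [set fun _ => 1].
  move=> f ->; split; first exact: polyfun_cst.
  by exists (fun=> 0%N) => c x; rewrite big1 ?mul1r.
rewrite setCT; apply/seteqP; split=> // p hp.
have [x px] := coords_exist p.
by have /eqP := hp _ erefl x px; rewrite oner_eq0.
Qed.

Lemma zariski_openI W : setI_closed (@zariski_open W).
Proof.
move=> A B [EA hA eA] [EB hB eB].
exists [set f | exists2 a, EA a & exists2 b, EB b & f = fun x => a x * b x].
  move=> _ [a /hA[pa [da ha]] [b /hB[pb [db hb]] ->]].
  split; first exact: polyfun_mul.
  exists (fun j => da j + db j)%N => c x; rewrite ha hb mulrACA -big_split /=.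
  by congr (_ * _); apply: eq_bigr => j _; rewrite exprD.
rewrite setCI eA eB; apply/seteqP; split=> p.
  by case=> hp _ [a Ea [b Eb ->]] x px;
    [rewrite (hp a Ea x px) mul0r|rewrite (hp b Eb x px) mulr0].
move=> hp; have [hpA|] := pselect (zero_locus EA p); first by left.
move=> /existsNP[a /not_implyP[Ea /existsNP[x /not_implyP[px ax]]]].
right=> b Eb y py.
have [d yd] := coords_scale px py.
have [_ [db hb]] := hB _ Eb.
rewrite yd hb.
have /eqP := hp _ (ex_intro2 _ _ a Ea (ex_intro2 _ _ b Eb erefl)) x px.
by rewrite mulf_eq0 => /orP[/eqP //|/eqP ->]; rewrite mulr0.
Qed.

Lemma zariski_open_bigU W (J : Type) (U : J -> set (multiproj W)) :
  (forall j, zariski_open (U j)) -> zariski_open (\bigcup_j U j).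
Proof.
move=> hU.
exists [set f | [/\ polyfun f, multihomogeneous f &
    exists j, forall p, ~ U j p -> forall x, coords p x -> f x = 0]].
  by move=> f [].
apply/seteqP; split=> p hp.
  by move=> f [_ _ [j hj]]; apply: hj => Ujp; apply: hp; exists j.
case=> j _; have [E hE eE] := hU j.
suff: (~` U j) p by [].
rewrite eE => f Ef x px; have [pf hf] := hE f Ef.
apply: hp px; split=> //; exists j => p' p'U.
have : (~` U j) p' by [].
by rewrite eE => /(_ f Ef).
Qed.

HB.instance Definition _ W := gen_eqMixin (multiproj W).
HB.instance Definition _ W := gen_choiceMixin (multiproj W).
HB.instance Definition _ W := isOpenTopological.Build (multiproj W)
  (@zariski_openT W) (@zariski_openI W) (@zariski_open_bigU W).

Lemma zariski_closedE W (Z : set (multiproj W)) : closed Z <-> algebraic_set Z.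
Proof.
rewrite -openC; suff -> : algebraic_set Z = zariski_open (~` Z) by [].
by rewrite /zariski_open setCK.
Qed.

End Zariski.

Definition irreducible_set (T : topologicalType) (A : set T) : Prop :=
  A !=set0 /\ forall B C : set T, closed B -> closed C ->
    A `<=` B `|` C -> A `<=` B \/ A `<=` C.

Section SymmetricPower.
Context {F : fieldType} {k : nat}.
Variables (omega : 'I_k -> nat) (V : 'I_k -> vectType F).

(* Arguments of a multilinear map on prod_i V_i^omega_i. *)
Definition sym_args : Type := forall i, 'I_(omega i) -> V i.

Definition set_arg (x : sym_args) i (a : 'I_(omega i)) (v : V i) : sym_args :=
  dfwith x (fun b => if b == a then v else x i b).

Definition multilinear (W : vectType F) (f : sym_args -> W) : Prop :=
  forall (x : sym_args) i (a : 'I_(omega i)),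
    linear (fun v : V i => f (set_arg x a v)).

(* Symmetric in the omega_i arguments taken in V_i, for each i. *)
Definition block_symmetric (W : vectType F) (f : sym_args -> W) : Prop :=
  forall (x : sym_args) (s : forall i, 'S_(omega i)),
    f (fun i a => x i (s i a)) = f x.

(* (S, m) is the tensor product over i of the symmetric powers S^omega_i V_i,
   given by its universal property; m sends (x_i,a) to the tensor product over
   i of the symmetric products x_i,1 ... x_i,omega_i. *)
Definition is_sym_power (S : vectType F) (m : sym_args -> S) : Prop :=
  [/\ multilinear m, block_symmetric m &
      forall (W : vectType F) (f : sym_args -> W),
        multilinear f -> block_symmetric f ->
        exists! g : 'Hom(S, W), forall x, f x = g (m x)].

Variables (S : vectType F) (m : sym_args -> S).

Definition pow_tensor (x : forall i, V i) : S := m (fun i _ => x i).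

(* One of the omega_i factors x_i is replaced by y. *)
Definition pow_tensor_repl (x : forall i, V i) i (y : V i) : S :=
  m (dfwith (fun j (_ : 'I_(omega j)) => x j)
            (fun a : 'I_(omega i) => if a == 0%N :> nat then y else x i)).

End SymmetricPower.

Section SpectralVariety.
Context {R : realType}.

Definition real_form (V : vectType R[i]) (W : set V) : Prop :=
  [/\ W 0,
      forall (a : R) u v, W u -> W v -> W (a%:C%C *: u + v) &
      forall v, exists! w : V * V, [/\ W w.1, W w.2 & v = w.1 + 'i%C *: w.2]].

(* Bilinearity of q over the complex numbers makes it the complexification of
   its restriction to the real form W. *)
Definition complexified_posdef (V : vectType R[i]) (q : {symmetric V}) : Prop :=
  exists W : set V, [/\ real_form W,
    forall u v, W u -> W v -> q u v \is Num.real &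
    forall w, W w -> w != 0 -> 0 < q w w].

Definition isotropic_quadric (V : vectType R[i]) (q : {symmetric V}) :
    set (projective V) :=
  [set L | forall x, (val L = <[x]>)%VS -> q x x = 0].

Context {k : nat}.
Variables (omega : 'I_k -> nat) (V : 'I_k -> vectType R[i]).
Variable q : forall i, {symmetric V i}.
Variables (S : vectType R[i]) (m : sym_args omega V -> S) (qF : {symmetric S}).

(* xget 0 A is an element of A; here A is a singleton because q i is
   nondegenerate. *)
Definition contraction (T : S) (x : forall i, V i) (i : 'I_k) : V i :=
  xget 0 [set v : V i | forall y, q i v y = qF T (pow_tensor_repl m x y)].

Definition singular_tuple (T : S) (x : forall i, V i) : Prop :=
  forall i, ~~ free [:: contraction T x i; x i].

(* The factors of P(S) x prod_i P(V_i): None indexes S, Some i indexes V_i. *)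
Definition spectral_factor (o : option 'I_k) : vectType R[i] :=
  if o is Some i then V i else S.

Definition spectral_variety : set (multiproj spectral_factor) :=
  [set p : multiproj spectral_factor | exists (T : S) (x : forall i, V i),
    [/\ val (p None) = <[T]>%VS,
        forall i, val (p (Some i)) = <[x i]>%VS &
        singular_tuple T x]].

Definition spectral_proj (p : multiproj spectral_factor) : multiproj V :=
  fun i => p (Some i).

Definition isotropic_product : set (multiproj V) :=
  [set p : multiproj V | forall i, isotropic_quadric (q i) (p i)].

End SpectralVariety.

(* Main.v *)
(* The singular tuple equations say that T is orthogonal to all tensors
   x_1^omega_1 ... x_i^(omega_i - 1) y ... x_k^omega_k with y orthogonal to x_i.
   The rank of this system jumps when several x_i are isotropic, so no
   vector-bundle argument applies over the whole of P.  Both assertions are proved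
   with rational curves instead.  Given z_i with q_i(z_i, x_i) = 1, adding to T a
   combination of rank one tensors near z_1^omega_1 ... z_k^omega_k changes the
   contractions of T at x into any prescribed vectors w_i such that q_i(w_i, x_i)
   does not depend on i.  For x_i moving on lines between nonisotropic vectors, with
   z_i proportional to x_i, this joins any two points of the part U of Sigma where
   no x_i is isotropic by a curve in U, so U is irreducible.  The same correction,
   with x_i moving from an isotropic vector in the direction of an isotropic z_i,
   shows that U is dense in Sigma. *)

Require Import Defs.
From HB Require Import structures.
From mathcomp Require Import all_boot all_fingroup all_order all_algebra.
From mathcomp Require Import sesquilinear complex.
From mathcomp Require Import ring.
From mathcomp Require Import boolp classical_sets reals topology.
Import Order.TTheory GRing.Theory Num.Theory.
Local Open Scope classical_set_scope.
Local Open Scope ring_scope.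

Set Implicit Arguments.
Unset Strict Implicit.
Unset Printing Implicit Defensive.

(** * Algebras of functions and vector-valued functions *)

Section FunctionAlgebra.
Context {F : fieldType} {A : Type}.

(** Abstract, so that the closure properties serve both for polynomial functions and for functions
    [regular B] along a curve. *)
Record function_algebra (P : (A -> F) -> Prop) : Prop := FunctionAlgebra {
  falg_cst : forall c, P (fun=> c);
  falg_add : forall f g, P f -> P g -> P (fun t => f t + g t);
  falg_mul : forall f g, P f -> P g -> P (fun t => f t * g t) }.

(** Testing against every linear form says that all coordinates lie in [P], without a choice of
    basis. *)
Definition vfun (P : (A -> F) -> Prop) (W : vectType F) (g : A -> W) : Prop :=
  forall l : {scalar W}, P (fun t => l (g t)).

Variable P : (A -> F) -> Prop.
Hypothesis HP : function_algebra P.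

Lemma falg_sum (J : Type) (r : seq J) (Q : pred J) (f : J -> A -> F) :
  (forall j, Q j -> P (f j)) -> P (fun t => \sum_(j <- r | Q j) f j t).
Proof.
move=> Pf; elim: r => [|j r IH].
  by under eq_fun do rewrite big_nil; exact: (falg_cst HP).
under eq_fun do rewrite big_cons.
by case Qj: (Q j) => //; apply: (falg_add HP) => //; apply: Pf.
Qed.

Lemma falg_prod (J : Type) (r : seq J) (Q : pred J) (f : J -> A -> F) :
  (forall j, Q j -> P (f j)) -> P (fun t => \prod_(j <- r | Q j) f j t).
Proof.
move=> Pf; elim: r => [|j r IH].
  by under eq_fun do rewrite big_nil; exact: (falg_cst HP).
under eq_fun do rewrite big_cons.
by case Qj: (Q j) => //; apply: (falg_mul HP) => //; apply: Pf.
Qed.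

Lemma falg_opp f : P f -> P (fun t => - f t).
Proof.
move=> Pf; under eq_fun do rewrite -mulN1r.
by apply: (falg_mul HP) => //; exact: (falg_cst HP).
Qed.

Lemma falg_sub f g : P f -> P g -> P (fun t => f t - g t).
Proof. by move=> Pf Pg; apply: (falg_add HP) => //; exact: falg_opp. Qed.

Lemma vfun_cst (W : vectType F) (w : W) : vfun P (fun=> w).
Proof. by move=> l; exact: (falg_cst HP). Qed.

Lemma vfun_add (W : vectType F) (g h : A -> W) :
  vfun P g -> vfun P h -> vfun P (fun t => g t + h t).
Proof.
move=> Pg Ph l; under eq_fun do rewrite linearD.
exact: (falg_add HP).
Qed.

Lemma vfun_scale (W : vectType F) (c : A -> F) (g : A -> W) :
  P c -> vfun P g -> vfun P (fun t => c t *: g t).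
Proof.
move=> Pc Pg l; under eq_fun do rewrite linearZ /=.
exact: (falg_mul HP).
Qed.

Lemma vfun_opp (W : vectType F) (g : A -> W) :
  vfun P g -> vfun P (fun t => - g t).
Proof.
by move=> Pg l; under eq_fun do rewrite linearN; exact: falg_opp.
Qed.

Lemma vfun_sub (W : vectType F) (g h : A -> W) :
  vfun P g -> vfun P h -> vfun P (fun t => g t - h t).
Proof. by move=> Pg Ph; apply: vfun_add => //; exact: vfun_opp. Qed.

Lemma vfun_sum (W : vectType F) (J : Type) (r : seq J) (Q : pred J)
    (g : J -> A -> W) :
  (forall j, Q j -> vfun P (g j)) ->
  vfun P (fun t => \sum_(j <- r | Q j) g j t).
Proof.
move=> Pg l; under eq_fun do rewrite linear_sum.
by apply: falg_sum => j Qj; exact: Pg.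
Qed.

Lemma vfun_form (W : vectType F) (b : {symmetric W}) (g h : A -> W) :
  vfun P g -> vfun P h -> P (fun t => b (g t) (h t)).
Proof.
move=> Pg Ph; set e := vbasis (@fullv _ W).
have -> : (fun t => b (g t) (h t)) =
    (fun t => \sum_i coord e i (g t) * (\sum_j coord e j (h t) * b e`_i e`_j)).
  apply: funext => t; rewrite {1}(coord_vbasis (memvf (g t))) linear_sumlz.
  apply: eq_bigr => i _; rewrite linearZl_LR /=; congr (_ * _).
  rewrite {1}(coord_vbasis (memvf (h t))) linear_sumr.
  by apply: eq_bigr => j _; rewrite linearZr_LR.
apply: falg_sum => i _; apply: (falg_mul HP); first exact: Pg.
apply: falg_sum => j _; apply: (falg_mul HP); first exact: Ph.
exact: (falg_cst HP).
Qed.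

End FunctionAlgebra.

(** * Multilinear maps and their slots *)

Section Multilinear.
Context {F : fieldType} {k : nat}.
Variables (omega : 'I_k -> nat) (V : 'I_k -> vectType F).
Local Notation args := (sym_args omega V).
Local Notation slot := {i : 'I_k & 'I_(omega i)}.
Local Notation Slot a := (Tagged (fun i => 'I_(omega i)) a).

Lemma set_arg_same (x : args) i (a : 'I_(omega i)) v : set_arg x a v a = v.
Proof. by rewrite /set_arg dfwith_in eqxx. Qed.

Lemma set_arg_other (x : args) i (a : 'I_(omega i)) v j (b : 'I_(omega j)) :
  Slot b != Slot a -> set_arg x a v b = x j b.
Proof.
rewrite /set_arg; case: (eqVneq i j) => [eij|nij]; last by rewrite dfwith_out.
subst j; rewrite dfwith_in; case: (eqVneq b a) => // ->.
by rewrite eqxx.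
Qed.

Lemma eq_args (x y : args) : (forall i (a : 'I_(omega i)), x i a = y i a) -> x = y.
Proof.
move=> exy; apply: functional_extensionality_dep => i.
by apply: functional_extensionality_dep => a; exact: exy.
Qed.

(** Replaces rewriting with [Slot b = Slot a], where the types of [a] and [b] depend on the
    block. *)
Lemma Slot_inj i (a : 'I_(omega i)) j (b : 'I_(omega j)) (Q : forall j, 'I_(omega j) -> Prop) :
  Slot b = Slot a -> Q i a -> Q j b.
Proof.
move=> e; have -> : Q j b = Q (tag (Slot b)) (tagged (Slot b)) by [].
by rewrite e.
Qed.

Lemma eq_args_slot i (a : 'I_(omega i)) (x y : args) : x i a = y i a ->
  (forall j (b : 'I_(omega j)), Slot b != Slot a -> x j b = y j b) -> x = y.
Proof.
move=> ea eb; apply: eq_args => j b.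
case: (eqVneq (Slot b) (Slot a)) => [e|]; last exact: eb.
exact: (Slot_inj (Q := fun j b => x j b = y j b) e).
Qed.

Lemma set_arg_id (x : args) i (a : 'I_(omega i)) : set_arg x a (x i a) = x.
Proof.
apply: (@eq_args_slot i a) => [|j b nba]; first by rewrite set_arg_same.
by rewrite set_arg_other.
Qed.

Variables (W : vectType F) (f : args -> W).
Hypothesis f_lin : multilinear f.

Lemma multilinearD x i (a : 'I_(omega i)) u v :
  f (set_arg x a (u + v)) = f (set_arg x a u) + f (set_arg x a v).
Proof. by have := f_lin x a 1 u v; rewrite !scale1r. Qed.

Lemma multilinear0 x i (a : 'I_(omega i)) : f (set_arg x a 0) = 0.
Proof.
have := multilinearD x a 0 0; rewrite addr0 => /eqP.
by rewrite -subr_eq0 opprD addrA subrr add0r oppr_eq0 => /eqP.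
Qed.

Lemma multilinearZ x i (a : 'I_(omega i)) c u :
  f (set_arg x a (c *: u)) = c *: f (set_arg x a u).
Proof. by have := f_lin x a c u 0; rewrite multilinear0 !addr0. Qed.

Lemma multilinear_sum x i (a : 'I_(omega i)) (J : Type) (r : seq J)
    (u : J -> V i) :
  f (set_arg x a (\sum_(j <- r) u j)) = \sum_(j <- r) f (set_arg x a (u j)).
Proof.
elim: r => [|j r IH]; first by rewrite !big_nil multilinear0.
by rewrite !big_cons multilinearD IH.
Qed.

Lemma multilinear_scale (c : 'I_k -> F) (x : args) :
  f (fun i a => c i *: x i a) = (\prod_i c i ^+ omega i) *: f x.
Proof.
(* One slot is scaled at a time; over all slots the product regroups by blocks, each giving
   [omega i] equal factors. *)
have H (s : seq slot) : uniq s ->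
    f (fun i a => if Slot a \in s then c i *: x i a else x i a) =
    (\prod_(p <- s) c (tag p)) *: f x.
  elim: s => [|[i a] s IH] /=; first by rewrite big_nil scale1r.
  move=> /andP[nas us]; rewrite big_cons /= -scalerA -(IH us).
  set y := (X in _ = _ *: f X).
  rewrite -(set_arg_id y a) -multilinearZ; congr f.
  apply: (@eq_args_slot i a) => [|j b nba].
    by rewrite set_arg_same /y mem_head (negPf nas).
  by rewrite set_arg_other // inE (negPf nba).
have := H (index_enum slot) (index_enum_uniq _).
have -> : (fun i a => if Slot a \in index_enum slot then c i *: x i a
                      else x i a) = (fun i a => c i *: x i a).
  by apply: eq_args => i a; rewrite mem_index_enum.
move=> ->; congr (_ *: _).
rewrite -(@sig_big_dep _ _ _ _ _ xpredT (fun=> xpredT) (fun i _ => c i)) /=.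
by apply: eq_bigr => i _; rewrite prodr_const card_ord.
Qed.

Lemma vfun_multilinear (A : Type) (P : (A -> F) -> Prop)
    (HP : function_algebra P) (X : A -> args) :
  (forall i a, vfun P (fun t => X t i a)) -> vfun P (fun t => f (X t)).
Proof.
(* Induction on the slots that may vary: expanding one in a basis replaces it by constant vectors,
   with coefficients in [P]. *)
have H (s : seq slot) (x0 : args) : forall Y : A -> args,
    (forall i a, vfun P (fun t => Y t i a)) ->
    (forall i (a : 'I_(omega i)), Slot a \notin s -> forall t, Y t i a = x0 i a) ->
    vfun P (fun t => f (Y t)).
  elim: s x0 => [|[i a] s IH] x0 Y PY Ys.
    have -> : (fun t => f (Y t)) = (fun=> f x0).
      by apply: funext => t; congr f; apply: eq_args => i a; exact: Ys.
    exact: vfun_cst.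
  set e := vbasis (@fullv _ (V i)).
  have -> : (fun t => f (Y t)) =
      (fun t => \sum_j coord e j (Y t i a) *: f (set_arg (Y t) a e`_j)).
    apply: funext => t; rewrite -{1}(set_arg_id (Y t) a).
    rewrite {1}(coord_vbasis (memvf (Y t i a))) multilinear_sum.
    by apply: eq_bigr => j _; rewrite multilinearZ.
  apply: vfun_sum => // j _; apply: vfun_scale => //; first exact: PY.
  apply: (IH (set_arg x0 a e`_j)) => i' b.
    case: (eqVneq (Slot b) (Slot a)) => [e1|nba].
      refine (Slot_inj (Q := fun i' b =>
        vfun P (fun t => set_arg (Y t) a e`_j b)) e1 _).
      by under eq_fun do rewrite set_arg_same; exact: vfun_cst.
    by under eq_fun do rewrite set_arg_other //; exact: PY.
  move=> bs t; case: (eqVneq (Slot b) (Slot a)) => [e1|nba].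
    refine (Slot_inj (Q := fun i' b =>
        set_arg (Y t) a e`_j b = set_arg x0 a e`_j b) e1 _).
    by rewrite !set_arg_same.
  by rewrite !set_arg_other //; apply: Ys; rewrite inE negb_or nba.
move=> PX; apply: (H (index_enum slot) (fun _ _ => 0)) => // i a.
by rewrite mem_index_enum.
Qed.

End Multilinear.

(** * Rational curves in the Zariski topology *)

Section Univariate.
Context {F : numFieldType}.

Lemma nonroot_exists (p : {poly F}) : p != 0 -> exists t, p.[t] != 0.
Proof.
move=> p0; apply: contrapT => /forallNP H.
have : (size [seq (i%:R : F) | i <- iota 0 (size p)] < size p)%N.
  apply: (max_poly_roots p0).
    apply/allP => x /mapP[i _ ->]; rewrite /root.
    by case: eqP => // /eqP /H.
  by rewrite map_inj_uniq ?iota_uniq // => i j /eqP; rewrite eqr_nat => /eqP.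
by rewrite size_map size_iota ltnn.
Qed.

Lemma horner_inj (p r : {poly F}) : (forall t, p.[t] = r.[t]) -> p = r.
Proof.
move=> e; apply/eqP; rewrite -subr_eq0; apply: contrapT => /negP.
by move=> /nonroot_exists[t]; rewrite !hornerE e subrr eqxx.
Qed.

(** [Q] holds outside a finite set of parameters; with a polynomial as witness, conjunction becomes
    a product. *)
Definition generic (Q : F -> Prop) : Prop :=
  exists p : {poly F}, p != 0 /\ forall t, p.[t] != 0 -> Q t.

Lemma generic_exists Q : generic Q -> exists t, Q t.
Proof. by move=> [p [/nonroot_exists[t pt] H]]; exists t; exact: H. Qed.

Lemma generic_and Q Q' : generic Q -> generic Q' -> generic (fun t => Q t /\ Q' t).
Proof.
move=> [p [p0 Hp]] [r [r0 Hr]]; exists (p * r); split; first by rewrite mulf_neq0.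
move=> t; rewrite hornerM mulf_eq0 negb_or => /andP[pt rt].
by split; [exact: Hp|exact: Hr].
Qed.

Lemma generic_imply (Q Q' : F -> Prop) : (forall t, Q t -> Q' t) -> generic Q -> generic Q'.
Proof. by move=> QQ' [p [p0 Hp]]; exists p; split=> // t /Hp /QQ'. Qed.

Lemma generic_forall (J : finType) (Q : J -> F -> Prop) :
  (forall j, generic (Q j)) -> generic (fun t => forall j, Q j t).
Proof.
move=> H; have {H} [p Hp] := choice H.
exists (\prod_j p j); split.
  by apply/prodf_neq0 => j _; have [] := Hp j.
move=> t; rewrite horner_prod => /prodf_neq0 pt j.
by have [_] := Hp j; apply; exact: pt.
Qed.

(* The values of [g] at the poles of the fraction [p / d] are unconstrained. *)
Definition regular (B : set F) (g : F -> F) : Prop :=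
  exists p d : {poly F}, (forall b, B b -> d.[b] != 0) /\
    forall t, d.[t] != 0 -> g t * d.[t] = p.[t].

Lemma regular_algebra B : function_algebra (regular B).
Proof.
split=> [c|f g [p [d [dB dP]]] [p' [d' [dB' dP']]]|f g [p [d [dB dP]]] [p' [d' [dB' dP']]]].
- exists c%:P, 1; split=> [b _|t _]; first by rewrite hornerC oner_eq0.
  by rewrite !hornerC mulr1.
- exists (p * d' + p' * d), (d * d'); split=> [b Bb|t].
    by rewrite hornerM mulf_neq0 ?dB ?dB'.
  rewrite hornerD !hornerM mulf_eq0 negb_or => /andP[dt dt'].
  by rewrite /= -dP // -dP' //; ring.
- exists (p * p'), (d * d'); split=> [b Bb|t].
    by rewrite hornerM mulf_neq0 ?dB ?dB'.
  rewrite !hornerM mulf_eq0 negb_or => /andP[dt dt'].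
  by rewrite /= -dP // -dP' //; ring.
Qed.

Lemma regular_id B : regular B id.
Proof.
exists 'X, 1; split=> [b _|t _]; first by rewrite hornerC oner_eq0.
by rewrite !hornerE.
Qed.

Lemma regular_inv B g : regular B g -> (forall b, B b -> g b != 0) ->
  regular B (fun t => (g t)^-1).
Proof.
(* The spare factor [d] in the denominator makes the relation between [g] and [p] available wherever
   that denominator is nonzero. *)
move=> [p [d [dB dP]]] gB; exists (d * d), (p * d); split=> [b Bb|t].
  by rewrite hornerM mulf_neq0 ?dB // -dP ?dB // mulf_neq0 ?dB ?gB.
rewrite !hornerM mulf_eq0 negb_or => /andP[pt dt].
move: pt; rewrite -dP // mulf_eq0 negb_or => /andP[gt _].
by field.
Qed.

Lemma regular_generic B g b : regular B g -> B b -> g b != 0 ->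
  generic (fun t => g t != 0).
Proof.
move=> [p [d [dB dP]]] Bb gb; exists (p * d); split.
  apply: contraTneq isT => pd0.
  have : (p * d).[b] != 0 by rewrite hornerM -dP ?dB // !mulf_neq0 ?dB.
  by rewrite pd0 horner0 eqxx.
move=> t; rewrite !hornerM mulf_eq0 negb_or => /andP[pt dt].
by apply: contraNneq pt => gt; rewrite -dP // gt mul0r.
Qed.

Lemma vfun_generic B (W : vectType F) (g : F -> W) b :
  vfun (regular B) g -> B b -> g b != 0 -> generic (fun t => g t != 0).
Proof.
move=> Hg Bb gb; set e := vbasis (@fullv _ W).
have [i ci] : exists i, coord e i (g b) != 0.
  apply: contrapT => /forallNP H; case/eqP: gb.
  rewrite (coord_vbasis (memvf (g b))) big1 // => i _.
  by have /negP/negbNE/eqP -> := H i; rewrite scale0r.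
apply: generic_imply (regular_generic (Hg (coord e i)) Bb ci) => t.
by apply: contraNneq => ->; rewrite linear0.
Qed.

End Univariate.

(** * Closed sets and irreducibility tested along curves *)

Section Curves.
Context {F : numFieldType} {I : finType}.
Variable W : I -> vectType F.

Lemma polyfun_algebra : function_algebra (@polyfun F I W).
Proof.
by split; [exact: polyfun_cst|exact: polyfun_add|exact: polyfun_mul].
Qed.

Lemma vfun_proj j : vfun (@polyfun F I W) (fun x => x j).
Proof. by move=> l; exact: polyfun_lin. Qed.

Lemma polyfun_comp (A : Type) (P : (A -> F) -> Prop) (HP : function_algebra P)
    (g : A -> forall j, W j) (f : (forall j, W j) -> F) :
  (forall j, vfun P (fun t => g t j)) -> polyfun f -> P (fun t => f (g t)).
Proof.
move=> Pg; elim=> [c|j l|f1 f2 _ H1 _ H2|f1 f2 _ H1 _ H2].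
- exact: (falg_cst HP).
- exact: Pg.
- exact: (falg_add HP).
- exact: (falg_mul HP).
Qed.

Lemma coords_neq0 (p : multiproj W) x j : coords p x -> x j != 0.
Proof.
move=> px; have := valP (p j); rewrite px dim_vline.
by case: (x j != 0).
Qed.

Lemma exists_point (x : forall j, W j) : (forall j, x j != 0) ->
  exists p : multiproj W, coords p x.
Proof.
move=> x0; have d1 j : \dim <[x j]> == 1%N by rewrite dim_vline x0.
by exists (fun j => exist _ <[x j]>%VS (d1 j)).
Qed.

Lemma multihomogeneous_coords (f : (forall j, W j) -> F) p x y :
  multihomogeneous f -> coords p x -> coords p y -> f x = 0 -> f y = 0.
Proof.
move=> [d hd] px py fx; have [c ->] := coords_scale px py.
by rewrite hd fx mulr0.
Qed.

(** Some equation of [Z] is nonzero at [g b]; along the curve it is a rational function regular at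
    [b], so it vanishes for finitely many parameters only. *)
Lemma curve_notin_generic (Z : set (multiproj W)) B b
    (g : F -> forall j, W j) p :
  closed Z -> B b -> (forall j, vfun (regular B) (fun t => g t j)) ->
  coords p (g b) -> ~ Z p ->
  generic (fun t => forall p', coords p' (g t) -> ~ Z p').
Proof.
move=> /zariski_closedE[E hE ->] Bb gB pg.
move=> /existsNP[f /not_implyP[Ef /existsNP[x /not_implyP[px fx]]]].
have [pf hf] := hE f Ef.
have fg : f (g b) != 0.
  by apply/eqP => fg0; apply: fx; exact: multihomogeneous_coords fg0.
have Hreg := polyfun_comp (regular_algebra B) gB pf.
apply: generic_imply (regular_generic Hreg Bb fg) => t /eqP ft p' pt Zp'.
exact/ft/Zp'.
Qed.

(** Otherwise a generic point of the curve would lie both in [Z] and outside it. Generically all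
    [g t j] are nonzero, so that such a point exists. *)
Lemma curve_closed (Z : set (multiproj W)) B b (g : F -> forall j, W j) p :
  closed Z -> B b -> (forall j, vfun (regular B) (fun t => g t j)) ->
  coords p (g b) -> generic (fun t => forall p', coords p' (g t) -> Z p') ->
  Z p.
Proof.
move=> cZ Bb gB pg gZ; apply: contrapT => nZ.
have gN : generic (fun t => forall j, g t j != 0).
  apply: generic_forall => j; apply: vfun_generic (gB j) Bb _.
  exact: coords_neq0 pg.
have := generic_and gN (generic_and gZ (curve_notin_generic cZ Bb gB pg nZ)).
move=> /generic_exists[t [/exists_point[p' pt] [Zt nZt]]].
exact: nZt pt (Zt p' pt).
Qed.

(** If [p] lies outside one closed set and [p'] outside another, a generic point of the curve
    joining them lies in [Z] and in neither. *)
Lemma irreducible_curves (Z : set (multiproj W)) : Z !=set0 ->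
  (forall p p', Z p -> Z p' -> exists g : F -> forall j, W j,
    [/\ forall j, vfun (regular [set b | b = 0 \/ b = 1]) (fun t => g t j),
        coords p (g 0), coords p' (g 1) &
        generic (fun t => forall r, coords r (g t) -> Z r)]) ->
  irreducible_set Z.
Proof.
move=> Z0 H; split=> // B C cB cC ZBC; apply: contrapT => /not_orP[].
move=> /existsNP[p /not_implyP[Zp nBp]] /existsNP[p' /not_implyP[Zp' nCp']].
have [g [gB pg pg' gZ]] := H p p' Zp Zp'.
have B0 : [set b : F | b = 0 \/ b = 1] 0 by left.
have B1 : [set b : F | b = 0 \/ b = 1] 1 by right.
have gN : generic (fun t => forall j, g t j != 0).
  apply: generic_forall => j; apply: vfun_generic (gB j) B0 _.
  exact: coords_neq0 pg.
have := generic_and (generic_and gN gZ)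
  (generic_and (curve_notin_generic cB B0 gB pg nBp)
               (curve_notin_generic cC B1 gB pg' nCp')).
move=> /generic_exists[t [[/exists_point[r rt] Zt] [nB nC]]].
by have [/nB|/nC] := ZBC _ (Zt r rt); apply.
Qed.

Lemma irreducible_dense (T : topologicalType) (A Z : set T) :
  irreducible_set A -> A `<=` Z -> Z `<=` closure A -> irreducible_set Z.
Proof.
move=> [[a Aa] iA] AZ ZA; split; first by exists a; exact: AZ.
move=> B C cB cC ZBC.
have sub D : closed D -> A `<=` D -> Z `<=` D.
  by move=> cD AD; rewrite closureE in ZA; move=> z /ZA; apply.
have [AB|AC] := iA _ _ cB cC (subset_trans AZ ZBC).
  by left; exact: sub.
by right; exact: sub.
Qed.

End Curves.

(** * Symmetric forms and prescribed contractions *)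

Section Forms.
Context {F : numFieldType} {V : vectType F}.
Variable q : {symmetric V}.

Lemma formC u v : q u v = q v u.
Proof. by rewrite hermC expr0 mul1r. Qed.
Lemma formDl u v w : q (u + v) w = q u w + q v w. Proof. exact: linearDl. Qed.
Lemma formDr u v w : q w (u + v) = q w u + q w v. Proof. exact: linearDr. Qed.
Lemma formZl c u w : q (c *: u) w = c * q u w. Proof. exact: linearZl_LR. Qed.
Lemma formZr c u w : q w (c *: u) = c * q w u.
Proof. by rewrite formC formZl formC. Qed.
Lemma formNl u w : q (- u) w = - q u w. Proof. exact: linearNl. Qed.
Lemma formNr u w : q w (- u) = - q w u. Proof. exact: linearNr. Qed.
Lemma form0l w : q 0 w = 0. Proof. exact: linear0l. Qed.
Lemma form0r w : q w 0 = 0. Proof. exact: linear0r. Qed.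
Lemma form_suml (J : Type) (r : seq J) (u : J -> V) w :
  q (\sum_(j <- r) u j) w = \sum_(j <- r) q (u j) w.
Proof. exact: linear_sumlz. Qed.
Lemma form_sumr (J : Type) (r : seq J) (u : J -> V) w :
  q w (\sum_(j <- r) u j) = \sum_(j <- r) q w (u j).
Proof. exact: linear_sumr. Qed.
Definition formE := (formDl, formDr, formZl, formZr, formNl, formNr, form0l, form0r).

Definition nondegenerate_form : Prop := forall v, (forall y, q v y = 0) -> v = 0.

Hypothesis q_nondeg : nondegenerate_form.

Lemma form_inj u v : (forall y, q u y = q v y) -> u = v.
Proof.
move=> e; apply/eqP; rewrite -subr_eq0; apply/eqP/q_nondeg => y.
by rewrite !formE e subrr.
Qed.

(** The map sending v to the sum of the q(v, e_i) e_i is injective by nondegeneracy, hence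
    bijective; the preimage of the sum of the l(e_i) e_i represents [l]. *)
Lemma form_represents (l : V -> F) :
  (forall a u v, l (a *: u + v) = a * l u + l v) ->
  exists y, forall v, q y v = l v.
Proof.
move=> llin; set e := vbasis (@fullv _ V).
have fe : free e by apply: basis_free (vbasisP _).
pose g v := \sum_(i < \dim {:V}) q v e`_i *: e`_i.
have glin : linear g.
  move=> a u v; rewrite scaler_sumr -big_split; apply: eq_bigr => i _ /=.
  by rewrite !formE scalerDl scalerA.
pose gL : {linear V -> V} := HB.pack g (GRing.isLinear.Build _ _ _ _ g glin).
have ginj : lker (linfun gL) == 0%VS.
  apply/lker0P => u v; rewrite !lfunE /= => guv; apply: form_inj => y.
  have quv (i : 'I_(\dim {:V})) : q u e`_i = q v e`_i.
    by rewrite -(coord_sum_free (fun i : 'I_(\dim {:V}) => q u e`_i) i fe) [X in coord _ _ X]guv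
               coord_sum_free.
  rewrite (coord_vbasis (memvf y)) !form_sumr.
  by apply: eq_bigr => i _; rewrite !formZr quv.
pose w := \sum_(i < \dim {:V}) l e`_i *: e`_i.
exists ((linfun gL)^-1%VF w) => v; set y := (_ w).
have gy : g y = w by rewrite -[RHS](lker0_lfunVK ginj) lfunE.
have qy (i : 'I_(\dim {:V})) : q y e`_i = l e`_i.
  by rewrite -(coord_sum_free (fun i : 'I_(\dim {:V}) => q y e`_i) i fe) [X in coord _ _ X]gy
             coord_sum_free.
pose lL : {scalar V} := HB.pack l (GRing.isLinear.Build _ _ _ _ l llin).
rewrite (coord_vbasis (memvf v)) form_sumr -[RHS]/(lL _) linear_sum.
by apply: eq_bigr => i _; rewrite formZr linearZ /= qy.
Qed.

Lemma form_dual x : x != 0 -> exists z, q z x = 1.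
Proof.
move=> x0; have [y yx] : exists y, q x y != 0.
  apply: contrapT => /forallNP H; case/eqP: x0; apply: q_nondeg => y.
  by apply/eqP; have /negP/negbNE := H y.
by exists ((q x y)^-1 *: y); rewrite formZl (formC y) mulVf.
Qed.

Lemma form_dual_isotropic x : x != 0 -> q x x = 0 ->
  exists z, q z x = 1 /\ q z z = 0.
Proof.
move=> x0 xx; have [u ux] := form_dual x0.
(* The coefficient solves q(u - a x, u - a x) = q(u, u) - 2 a = 0. *)
exists (u - (q u u / 2) *: x); rewrite !formE xx (formC x) ux; split; first by ring.
by field.
Qed.

Lemma form_colinear v x : x != 0 -> (forall y, q x y = 0 -> q v y = 0) ->
  exists c, v = c *: x.
Proof.
move=> x0 H; have [z zx] := form_dual x0.
exists (q v z); apply: form_inj => y; rewrite formZl.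
(* This is the component of [y] orthogonal to [x] along [z]. *)
have := H (y - q x y *: z); rewrite !formE (formC x z) zx mulr1 subrr.
by move=> /(_ erefl)/eqP; rewrite subr_eq0 mulrC => /eqP.
Qed.

(** Every linear form is a pairing with some vector; this suits contractions, which are known
    through their pairings. *)
Lemma vfun_represented (A : Type) (P : (A -> F) -> Prop) (g : A -> V) :
  (forall y, P (fun t => q (g t) y)) -> vfun P g.
Proof.
move=> H l; have llin : forall a u v, l (a *: u + v) = a * l u + l v.
  by move=> a u v; rewrite linearP.
have [y yl] := form_represents llin.
by under eq_fun do rewrite -yl formC.
Qed.

End Forms.

(** * Polarization of the Frobenius form and correction of tensors *)

Section Polarization.
Context {F : numFieldType} {k : nat}.
Variables (omega : 'I_k -> nat) (V : 'I_k -> vectType F).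
Hypothesis omega_gt0 : forall i, (0 < omega i)%N.
Local Notation args := (sym_args omega V).
Local Notation slot := {i : 'I_k & 'I_(omega i)}.
Local Notation Slot a := (Tagged (fun i => 'I_(omega i)) a).

(** The linear coefficient is the derivative at [X] in the direction [D], one term per slot; the
    slots are set in motion one after another. *)
Lemma multilinear_coef1 (f : args -> F^o) (X D : args) : multilinear f ->
  exists p : {poly F},
    (forall t, f (fun i a => X i a + t *: D i a) = p.[t]) /\
    p`_1 = \sum_(s : slot) f (set_arg X (tagged s) (D (tag s) (tagged s))).
Proof.
move=> f_lin.
have H (s : seq slot) : uniq s -> forall X : args, exists p : {poly F},
    [/\ forall t, f (fun i a => if Slot a \in s then X i a + t *: D i a
                                else X i a) = p.[t],
        p`_0 = f X &
        p`_1 = \sum_(r <- s) f (set_arg X (tagged r) (D (tag r) (tagged r)))].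
  elim: s => [|[i a] s IH] /=.
    by move=> _ Y; exists (f Y)%:P; split=> [t||];
      rewrite ?hornerC ?coefC ?big_nil.
  move=> /andP[nas us] Y.
  have [p [pf p0 p1]] := IH us Y.
  have [r [rf r0 r1]] := IH us (set_arg Y a (D i a)).
  exists (p + 'X * r); split=> [t||].
  - rewrite !hornerE -pf -rf.
    set Z := (X in _ = f X + _); set Z' := (X in _ = _ + _ * f X).
    have -> : Z' = set_arg Z a (D i a).
      apply: (@eq_args_slot _ _ _ _ i a) => [|j b nba].
        by rewrite /Z' (negPf nas) !set_arg_same.
      by rewrite set_arg_other // /Z' /Z set_arg_other.
    rewrite -{1}(set_arg_id Z a) -[t * _]/(t *: (f _ : F^o)).
    rewrite -multilinearZ // -multilinearD //; congr f.
    apply: (@eq_args_slot _ _ _ _ i a) => [|j b nba].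
      by rewrite set_arg_same /Z mem_head (negPf nas).
    by rewrite set_arg_other // inE (negPf nba).
  - by rewrite coefD coefXM addr0.
  - by rewrite coefD coefXM /= p1 r0 big_cons addrC.
have [p [pf _ p1]] := H (index_enum slot) (index_enum_uniq _) X.
exists p; split=> // t; rewrite -pf; congr f.
by apply: eq_args => i a; rewrite mem_index_enum.
Qed.

Variables (S : vectType F) (m : args -> S).
Hypotheses (m_lin : multilinear m) (m_sym : block_symmetric m).

Lemma pow_tensor_replE x i y : pow_tensor_repl m x y =
  m (set_arg (fun j _ => x j) (Ordinal (omega_gt0 i)) y).
Proof. by []. Qed.

Lemma pow_tensor_repl_id x i : pow_tensor_repl m x (x i) = pow_tensor m x.
Proof.
rewrite pow_tensor_replE; congr m.
exact: (set_arg_id (fun j _ => x j : V j) (Ordinal (omega_gt0 i))).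
Qed.

(** [pow_tensor_repl] uses the first slot of the block; a transposition, under which [m] is
    invariant, moves [y] there. *)
Lemma pow_tensor_repl_slot x i (a : 'I_(omega i)) y :
  m (set_arg (fun j _ => x j) a y) = pow_tensor_repl m x y.
Proof.
rewrite pow_tensor_replE; set a0 := Ordinal _.
pose s : forall j, 'S_(omega j) := 
  @dfwith _ (fun j => 'S_(omega j)) (fun=> 1%g) i (tperm a a0).
rewrite -(m_sym (set_arg (fun j _ => x j) a0 y) s); congr m.
apply: (@eq_args_slot _ _ _ _ i a) => [|j b nba].
  by rewrite set_arg_same /s dfwith_in tpermL set_arg_same.
rewrite !set_arg_other //; case: (eqVneq i j) => [eij|nij]; last first.
  by apply: contra nij => /eqP/(congr1 tag)/= ->.
subst j; rewrite /s dfwith_in; apply: contra nba => /eqP e.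
have {}e : tperm a a0 b = a0 := eq_from_Tagged e.
by apply/eqP; congr Tagged; rewrite -[b](tpermK a a0) e tpermR.
Qed.

Variables (q : forall i, {symmetric V i}) (qF : {symmetric S}).
Hypothesis hqF : forall x y : forall i, V i,
  qF (pow_tensor m x) (pow_tensor m y) = \prod_i q i (x i) (y i) ^+ omega i.

Lemma form_multilinear T : multilinear (fun X : args => qF T (m X) : F^o).
Proof. by move=> X i a c u v; rewrite m_lin !formE. Qed.

(** [qF] is prescribed on pure powers only. Moving x_i to x_i + t y gives (1 + t q_i(z_i,
    y))^omega_i; computed by slots, its linear coefficient is omega_i times the left-hand side, and
    omega_i is invertible. *)
Lemma form_pow_tensor_repl z x i y : (forall j, q j (z j) (x j) = 1) ->
  qF (pow_tensor m z) (pow_tensor_repl m x y) = q i (z i) y.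
Proof.
move=> zx; pose d : forall j, V j := @dfwith _ (fun j => V j) (fun=> 0) i y.
have [p [pE p1]] := multilinear_coef1 (fun j _ => x j) (fun j _ => d j)
  (form_multilinear (pow_tensor m z)).
set c := q i (z i) y.
have pX : p = ('X * c%:P + 1) ^+ omega i.
  apply: horner_inj => t; rewrite -pE.
  rewrite -[m _]/(pow_tensor m (fun j => x j + t *: d j)) hqF.
  rewrite (bigD1 i) //= big1 ?mulr1 => [|j ji].
    by rewrite !formE zx /d dfwith_in !hornerE addrC.
  by rewrite !formE zx /d dfwith_out 1?eq_sym // form0r mulr0 addr0 expr1n.
have : p`_1 = c *+ omega i.
  have -> : p`_1 = p^`()`_0 by rewrite coef_deriv.
  rewrite pX -horner_coef0 deriv_exp hornerMn hornerM horner_exp.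
  rewrite derivD derivM derivX !derivC !hornerE /=.
  by rewrite expr1n mulr1.
rewrite p1 -(@sig_big_dep _ _ _ _ _ xpredT (fun=> xpredT) (fun j a =>
  qF (pow_tensor m z) (m (set_arg (fun j _ => x j) a (d j))))) /=.
rewrite (bigD1 i) //= [X in _ + X]big1 => [|j ji]; last first.
  rewrite big1 // => a _; rewrite /d dfwith_out 1?eq_sym //.
  by rewrite multilinear0 // form0r.
under eq_bigr do rewrite pow_tensor_repl_slot /d dfwith_in.
rewrite sumr_const card_ord addr0 => /eqP.
by rewrite eqr_pMn2r // => /eqP.
Qed.

(** [v] stands for the contractions of [T] at a point, [w] for the prescribed ones. The multiple [c]
    of the power of [z] repairs the value of [T] on the power of that point, the sum repairs what is
    left in each contraction. *)
Definition adjust (T : S) (z v w : forall i, V i) (c : F) : S :=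
  T + (c *: pow_tensor m z + \sum_i (pow_tensor m
    (dfwith z (z i + (w i - v i - c *: z i))) - pow_tensor m z)).

(* Adding to z i a vector orthogonal to x i moves only the i-th contraction at x
   of pow_tensor m z. *)
Lemma form_adjust T x z v w s :
  (forall i, q i (z i) (x i) = 1) ->
  (forall i y, q i (v i) y = qF T (pow_tensor_repl m x y)) ->
  (forall i, q i (w i) (x i) = s) ->
  forall i y, qF (adjust T z v w (s - qF T (pow_tensor m x)))
    (pow_tensor_repl m x y) = q i (w i) y.
Proof.
move=> zx vT ws i y; rewrite /adjust; set c := s - _.
pose phi j := w j - v j - c *: z j; rewrite -/phi.
(* Both [w j] and [v j + c *: z j] pair with [x j] to [s]. *)
have phix j : q j (phi j) (x j) = 0.
  by rewrite /phi !formE ws vT zx pow_tensor_repl_id /c; ring.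
rewrite !formDl formZl form_pow_tensor_repl // form_suml -vT.
have E j : qF (pow_tensor m (dfwith z (z j + phi j)) - pow_tensor m z)
    (pow_tensor_repl m x y) = q i (dfwith z (z j + phi j) i) y - q i (z i) y.
  rewrite formDl formNl !form_pow_tensor_repl // => h.
  by case: dfwithP => // ; rewrite formDl phix addr0 zx.
rewrite (bigD1 i) //= big1 => [|j ji].
  by rewrite E dfwith_in /phi !formE; ring.
by rewrite E dfwith_out // subrr.
Qed.

Lemma adjust_id T z v : adjust T z v v 0 = T.
Proof.
rewrite /adjust scale0r add0r big1 ?addr0 // => i _.
apply/eqP; rewrite subr_eq0; apply/eqP; congr pow_tensor.
apply: functional_extensionality_dep => j.
by rewrite scale0r subrr subr0 addr0; case: dfwithP.
Qed.

Lemma vfun_pow_tensor (A : Type) (P : (A -> F) -> Prop)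
    (HP : function_algebra P) (x : A -> forall i, V i) :
  (forall i, vfun P (fun t => x t i)) -> vfun P (fun t => pow_tensor m (x t)).
Proof. by move=> Px; apply: (vfun_multilinear m_lin HP) => i a; exact: Px. Qed.

Lemma vfun_set_arg (A : Type) (P : (A -> F) -> Prop) (X : A -> args) i
    (a : 'I_(omega i)) (y : A -> V i) :
  (forall j (b : 'I_(omega j)), vfun P (fun t => X t j b)) -> vfun P y ->
  forall j (b : 'I_(omega j)), vfun P (fun t => set_arg (X t) a (y t) b).
Proof.
move=> PX Py j b; case: (eqVneq (Slot b) (Slot a)) => [e|nba].
  refine (Slot_inj (Q := fun j b => vfun P (fun t => set_arg (X t) a (y t) b)) e _).
  by under eq_fun do rewrite set_arg_same.
by under eq_fun do rewrite set_arg_other //; exact: PX.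
Qed.

Lemma vfun_pow_tensor_repl (A : Type) (P : (A -> F) -> Prop)
    (HP : function_algebra P) (x : A -> forall i, V i) i (y : A -> V i) :
  (forall i, vfun P (fun t => x t i)) -> vfun P y ->
  vfun P (fun t => pow_tensor_repl m (x t) (y t)).
Proof.
move=> Px Py; under eq_fun do rewrite pow_tensor_replE.
apply: (vfun_multilinear m_lin HP); apply: vfun_set_arg => // j b; exact: Px.
Qed.

Lemma vfun_adjust (A : Type) (P : (A -> F) -> Prop)
    (HP : function_algebra P) (T : A -> S) (z v w : A -> forall i, V i)
    (c : A -> F) :
  vfun P T -> (forall i, vfun P (fun t => z t i)) ->
  (forall i, vfun P (fun t => v t i)) -> (forall i, vfun P (fun t => w t i)) ->
  P c -> vfun P (fun t => adjust (T t) (z t) (v t) (w t) (c t)).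
Proof.
move=> PT Pz Pv Pw Pc; apply: vfun_add => //.
have Ppow := vfun_pow_tensor HP Pz.
apply: vfun_add => //; first exact: vfun_scale.
apply: vfun_sum => // i _; apply: vfun_sub => //; apply: vfun_pow_tensor => // j.
case: (eqVneq i j) => [eij|nij].
  subst j; under eq_fun do rewrite dfwith_in.
  apply: vfun_add => //; apply: vfun_sub => //; first exact: vfun_sub.
  exact: vfun_scale.
by under eq_fun do rewrite dfwith_out //; exact: Pz.
Qed.

End Polarization.

(** * The spectral variety *)

Section ComplexForms.
Context {R : realType}.
Variables (V : vectType R[i]) (q : {symmetric V}).
Hypothesis hq : complexified_posdef q.

(** With v = w1 + i w2 over the real form, w1 - i w2 is the conjugate of v, and the pairing is the
    Hermitian norm. *)
Lemma complexified_posdef_real v : v != 0 -> exists w1 w2,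
  [/\ q v (w1 - 'i%C *: w2) = q w1 w1 + q w2 w2, 0 <= q w1 w1, 0 <= q w2 w2 &
      q w1 w1 + q w2 w2 != 0].
Proof.
have [W [[W0 _ Wdec] _ Wpos]] := hq.
have Wge0 w : W w -> 0 <= q w w.
  move=> Ww; have [->|w0] := eqVneq w 0; first by rewrite form0l.
  exact/ltW/Wpos.
move=> v0; have [[w1 w2] [[/= Ww1 Ww2 ev] _]] := Wdec v.
exists w1, w2; split; rewrite ?Wge0 //.
  have i2 : 'i%C * 'i%C = -1 :> R[i] by rewrite -expr2 sqr_i.
  rewrite ev !formE (formC q w2 w1). ring: i2.
apply: contra v0; rewrite paddr_eq0 ?Wge0 // => /andP[q1 q2].
have Weq0 w : W w -> q w w == 0 -> w = 0.
  by move=> Ww; apply: contraTeq => w0; rewrite gt_eqF // Wpos.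
by rewrite ev (Weq0 _ Ww1 q1) (Weq0 _ Ww2 q2) scaler0 addr0.
Qed.

Lemma complexified_posdef_nondegenerate : nondegenerate_form q.
Proof.
move=> v v0; apply/eqP; apply: contrapT => /negP/complexified_posdef_real.
by move=> [w1 [w2 [+ _ _]]]; rewrite v0 => <-; rewrite eqxx.
Qed.

Lemma complexified_posdef_nonisotropic : (0 < \dim {:V})%N ->
  exists x, q x x != 0.
Proof.
rewrite lt0n dimv_eq0 -vpick0 => /complexified_posdef_real.
move=> [w1 [w2 [_ _ _]]] q12; have [q1|] := eqVneq (q w1 w1) 0.
  by exists w2; move: q12; rewrite q1 add0r.
by exists w1.
Qed.

End ComplexForms.

Lemma dependent_choice_fun (I : Type) (T : I -> Type) (P : forall i, T i -> Prop) :
  (forall i, exists x, P i x) -> exists f : forall i, T i, forall i, P i (f i).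
Proof. by move=> H; exists (fun i => projT1 (cid (H i))) => i; case: cid. Qed.

(** * Equations of the spectral variety and its nonisotropic part *)

Section SpectralVariety.
Context {R : realType} {k : nat}.
Variables (omega : 'I_k -> nat) (V : 'I_k -> vectType R[i]).
Hypothesis omega_gt0 : forall i, (0 < omega i)%N.
Variable q : forall i, {symmetric V i}.
Hypothesis q_nondeg : forall i, nondegenerate_form (q i).
Variables (S : vectType R[i]) (m : sym_args omega V -> S).
Hypotheses (m_lin : multilinear m) (m_sym : block_symmetric m).
Variable qF : {symmetric S}.
Hypothesis hqF : forall x y : forall i, V i,
  qF (pow_tensor m x) (pow_tensor m y) = \prod_i q i (x i) (y i) ^+ omega i.

Local Notation factor := (spectral_factor V S).
Local Notation Sigma := (spectral_variety q m qF).

Lemma pow_tensor_repl_linear T x i a (u v : V i) :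
  qF T (pow_tensor_repl m x (a *: u + v)) =
  a * qF T (pow_tensor_repl m x u) + qF T (pow_tensor_repl m x v).
Proof. by rewrite !(pow_tensor_replE omega_gt0) m_lin !formE. Qed.

Lemma contractionP T x i y :
  q i (contraction q m qF T x i) y = qF T (pow_tensor_repl m x y).
Proof.
rewrite /contraction; case: xgetP => [v -> //|nex].
have [v vP] := form_represents (@q_nondeg i) (@pow_tensor_repl_linear T x i).
by case: (nex v).
Qed.

(** Linear dependence freed from [contraction]; when x_i is nonzero the contraction must be the
    multiple. *)
Definition singular_eqns (X : forall o, factor o) : Prop := forall i,
  exists c, forall y, qF (X None) (pow_tensor_repl m (fun j => X (Some j)) y) =
                      c * q i (X (Some i)) y.

Lemma singular_tupleP (X : forall o, factor o) : (forall i, X (Some i) != 0) ->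
  singular_tuple q m qF (X None) (fun i => X (Some i)) <-> singular_eqns X.
Proof.
move=> X0; split=> H i.
  have := H i; rewrite free_cons seq1_free span_seq1 X0 andbT negbK.
  move=> /vlineP[c e]; exists c => y.
  by rewrite -contractionP e formZl.
rewrite free_cons seq1_free span_seq1 X0 andbT negbK; apply/vlineP.
have [c e] := H i; exists c; apply: (form_inj (@q_nondeg i)) => y.
by rewrite contractionP formZl e.
Qed.

(* Scaling x i scales the vector put in the slot, which is orthogonal to x i, so
   that the expression is homogeneous of degree omega i in x i. *)
Definition singular_minor i (y y' : V i) (X : forall o, factor o) : R[i] :=
  qF (X None) (pow_tensor_repl m (fun j => X (Some j))
    (q i (X (Some i)) y' *: y - q i (X (Some i)) y *: y')).

(** The vectors q_i(x_i, y') y - q_i(x_i, y) y' fill the orthogonal complement of x_i, and whatever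
    is orthogonal to that complement is a multiple of x_i. *)
Lemma singular_eqns_minor (X : forall o, factor o) : (forall i, X (Some i) != 0) ->
  singular_eqns X <-> forall i (y y' : V i), singular_minor y y' X = 0.
Proof.
move=> X0; split=> H i.
  move=> y y'; have [c e] := H i.
  by rewrite /singular_minor e !formE; ring.
have [z zx] := form_dual (@q_nondeg i) (X0 i).
have [y xy|c e] := form_colinear (@q_nondeg i)
    (v := contraction q m qF (X None) (fun j => X (Some j)) i) (X0 i).
  have := H i y z; rewrite /singular_minor xy (formC (q i) (X (Some i)) z) zx scale1r scale0r subr0.
  by rewrite contractionP.
by exists c => y; rewrite -contractionP e formZl.
Qed.

Lemma polyfun_singular_minor i (y y' : V i) : polyfun (singular_minor y y').
Proof.
have PA := polyfun_algebra factor; have Pp o := @vfun_proj _ _ factor o.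
apply: (vfun_form PA qF (Pp None)).
apply: (vfun_pow_tensor_repl omega_gt0 m_lin PA) => [j|]; first exact: Pp (Some j).
apply: (vfun_sub PA); apply: (vfun_scale PA); last exact: (vfun_cst PA).
- by apply: (vfun_form PA _ (Pp (Some i))); exact: (vfun_cst PA).
- exact: (vfun_cst PA).
- by apply: (vfun_form PA _ (Pp (Some i))); exact: (vfun_cst PA).
Qed.

Lemma pow_tensor_repl_scale (c : 'I_k -> R[i]) x i (y : V i) :
  pow_tensor_repl m (fun j => c j *: x j) (c i *: y) =
  (\prod_j c j ^+ omega j) *: pow_tensor_repl m x y.
Proof.
rewrite !(pow_tensor_replE omega_gt0) -multilinear_scale //; congr m.
apply: (@eq_args_slot _ _ _ _ i (Ordinal (omega_gt0 i))) => [|j b nb].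
  by rewrite !set_arg_same.
by rewrite !set_arg_other.
Qed.

Lemma multihomogeneous_singular_minor i (y y' : V i) :
  multihomogeneous (singular_minor y y').
Proof.
exists (fun o => if o is Some j then omega j else 1%N) => c X.
rewrite /singular_minor; set u := (X in _ = _ * qF _ (pow_tensor_repl m _ X)).
set u' := (X in qF _ (pow_tensor_repl m _ X) = _).
have -> : u' = c (Some i) *: u.
  by rewrite /u' /u !formE scalerBr !scalerA.
rewrite (pow_tensor_repl_scale (fun j => c (Some j)) (fun j => X (Some j)) u).
rewrite !formE (bigD1 None) //= expr1 mulrA; congr (_ * _ * _).
rewrite (reindex_omap Some id) //=; last by case.
by apply: eq_big => // j; rewrite eqxx.
Qed.

Definition spectral_coords (T : S) (x : forall i, V i) : forall o, factor o :=
  fun o => if o is Some i then x i else T.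

Lemma spectral_zero_locus : Sigma =
  zero_locus [set f | exists i (y y' : V i), f = singular_minor y y'].
Proof.
apply/seteqP; split=> p.
  move=> [T [x [pT px sing]]] _ [i [y [y' ->]]] X pX.
  have pTx : coords p (spectral_coords T x) by case.
  have x0 j : spectral_coords T x (Some j) != 0 by exact: coords_neq0 pTx.
  apply: multihomogeneous_coords pTx pX _; first exact: multihomogeneous_singular_minor.
  by apply: (singular_eqns_minor x0).1 => //; apply/(singular_tupleP x0).
move=> H; have [X pX] := coords_exist p.
exists (X None), (fun i => X (Some i)); split=> //.
have X0 i : X (Some i) != 0 by exact: coords_neq0 pX.
apply/(singular_tupleP X0)/(singular_eqns_minor X0) => i y y'.
by apply: H pX; exists i, y, y'.
Qed.

Lemma spectral_closed : closed Sigma.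
Proof.
apply/zariski_closedE; rewrite spectral_zero_locus.
eexists; last by []; move=> _ [i [y [y' ->]]].
by split; [exact: polyfun_singular_minor|exact: multihomogeneous_singular_minor].
Qed.

(** [spectral_variety] speaks of some representatives; homogeneous equations allow any. *)
Lemma spectral_coordsP p X : coords p X -> Sigma p <-> singular_eqns X.
Proof.
move=> pX; have X0 i : X (Some i) != 0 by exact: coords_neq0 pX.
split=> [|H].
  rewrite spectral_zero_locus => H; apply/(singular_eqns_minor X0) => i y y'.
  by apply: H pX; exists i, y, y'.
exists (X None), (fun i => X (Some i)); split=> //.
exact/singular_tupleP.
Qed.

(** All entries are nonisotropic here, while one such entry suffices for lying over the complement
    of [isotropic_product]. *)
Definition nonisotropic_part : set (multiproj factor) :=
  [set p | Sigma p /\ exists2 X, coords p X &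
     forall i, q i (X (Some i)) (X (Some i)) != 0].

Lemma vfun_contraction (A : Type) (P : (A -> R[i]) -> Prop)
    (HP : function_algebra P) T x i :
  vfun P T -> (forall j, vfun P (fun t => x t j)) ->
  vfun P (fun t => contraction q m qF (T t) (x t) i).
Proof.
move=> PT Px; apply: (vfun_represented (@q_nondeg i)) => y.
under eq_fun do rewrite contractionP.
apply: (vfun_form HP qF PT); apply: (vfun_pow_tensor_repl omega_gt0) => //.
exact: (vfun_cst HP).
Qed.

Lemma vfun_spectral_coords (A : Type) (P : (A -> R[i]) -> Prop) T x :
  vfun P T -> (forall j, vfun P (fun t : A => x t j)) ->
  forall o, vfun P (fun t => spectral_coords (T t) (x t) o).
Proof. by move=> PT Px [i|]; [exact: Px|exact: PT]. Qed.

Lemma nonisotropic_part_irreducible : (forall i, exists x, q i x x != 0) ->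
  irreducible_set nonisotropic_part.
Proof.
move=> /dependent_choice_fun[x0 x0P]; apply: irreducible_curves.
  (* Nonemptiness: the power of [z] has contractions [z i] at [x0], which are multiples of
     [x0 i]. *)
  pose z i := (q i (x0 i) (x0 i))^-1 *: x0 i.
  have zx i : q i (z i) (x0 i) = 1 by rewrite formZl mulVf.
  have z0 : pow_tensor m z != 0.
    apply: contraTneq isT => z0; have := hqF z x0.
    rewrite z0 form0l big1 => [/eqP|i _]; last by rewrite zx expr1n.
    by rewrite eq_sym oner_eq0.
  have [|p pX] := @exists_point _ _ factor (spectral_coords (pow_tensor m z) x0).
    case=> //= i; apply: contra (x0P i) => /eqP ->.
    by rewrite form0l.
  exists p; split; last by exists (spectral_coords (pow_tensor m z) x0).
  apply/(spectral_coordsP pX) => i; exists (q i (x0 i) (x0 i))^-1 => y /=.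
  by rewrite (form_pow_tensor_repl omega_gt0 m_lin m_sym hqF) // formZl.
move=> p p' [Sp [X pX Xq]] [Sp' [X' pX' Xq']].
set B := [set b | b = 0 \/ b = 1]; have HB := regular_algebra B.
pose T0 t := X None + t *: (X' None - X None).
pose x t i := X (Some i) + t *: (X' (Some i) - X (Some i)).
pose N t i := q i (x t i) (x t i).
pose z t i := (N t i)^-1 *: x t i.
(* The prescribed contractions are the multiples of [x t i] pairing with it to the value that [T0 t]
   already has on the power of [x t]. So [adjust] gets the scalar zero, written [s t - s t] to match
   [form_adjust]. *)
pose s t := qF (T0 t) (pow_tensor m (x t)).
pose v t i := contraction q m qF (T0 t) (x t) i.
pose w t i := (s t * (N t i)^-1) *: x t i.
pose g t := spectral_coords (adjust m (T0 t) (z t) (v t) (w t) (s t - s t)) (x t).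
have line (W : vectType R[i]) (a b : W) : vfun (regular B) (fun t => a + t *: (b - a)).
  apply: (vfun_add HB); first exact: (vfun_cst HB).
  by apply: (vfun_scale HB); [exact: regular_id|exact: (vfun_cst HB)].
have rx i : vfun (regular B) (fun t => x t i) by exact: line.
have rT : vfun (regular B) T0 by exact: line.
have X0 i : X (Some i) != 0 by exact: coords_neq0 pX.
have x_0 : x 0 = fun i => X (Some i).
  by apply: functional_extensionality_dep => i; rewrite /x scale0r addr0.
have x_1 : x 1 = fun i => X' (Some i).
  by apply: functional_extensionality_dep => i; rewrite /x scale1r addrC subrK.
have NB i b : B b -> N b i != 0.
  by case=> ->; rewrite /N ?x_0 ?x_1.
have rN i : regular B (fun t => N t i) by exact: (vfun_form HB (q i) (rx i) (rx i)).
have rNV i : regular B (fun t => (N t i)^-1) by apply: regular_inv => // b; exact: NB.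
have rs : regular B s.
  by apply: (vfun_form HB qF rT); exact: vfun_pow_tensor.
have rg o : vfun (regular B) (fun t => g t o).
  apply: vfun_spectral_coords => //; apply: vfun_adjust => //.
  - by move=> i; exact: (vfun_scale HB (rNV i) (rx i)).
  - by move=> i; exact: (@vfun_contraction _ _ HB T0 x i rT rx).
  - by move=> i; exact: (vfun_scale HB (falg_mul HB rs (rNV i)) (rx i)).
  - exact: (falg_sub HB rs rs).
(* At the endpoints the tuple is already singular, with coefficients s / N_i, so the correction
   vanishes. *)
have gend b (Y : forall o, factor o) r : B b -> T0 b = Y None ->
    x b = (fun i => Y (Some i)) -> coords r Y -> Sigma r -> coords r (g b).
  move=> Bb Tb xb rY Sr; suff -> : g b = Y by [].
  have vw : v b = w b.
    apply: functional_extensionality_dep => i.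
    have [c e] := (spectral_coordsP rY).1 Sr i.
    have qv y : q i (v b i) y = c * q i (x b i) y.
      by rewrite contractionP Tb xb e.
    apply: (form_inj (@q_nondeg i)) => y; rewrite qv formZl; congr (_ * _).
    have : c * N b i = s b.
      by rewrite /N -qv contractionP (pow_tensor_repl_id omega_gt0).
    by move=> <-; rewrite mulfK ?NB.
  apply: functional_extensionality_dep => -[i|]; rewrite /g /=; first by rewrite xb.
  by rewrite vw subrr adjust_id.
exists g; split=> //.
- by apply: gend pX Sp; [left|rewrite /T0 scale0r addr0|].
- by apply: gend pX' Sp'; [right|rewrite /T0 scale1r addrC subrK|].
(* The segments may meet isotropic vectors, but for finitely many [t] only, as [N 0 i] is
   nonzero. *)
have gN : generic (fun t => forall i, N t i != 0).
  by apply: generic_forall => i; apply: (@regular_generic _ B _ 0) => //;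
    [left|apply: NB; left].
apply: generic_imply gN => t Nt r rX; split; last by exists (g t).
apply/(spectral_coordsP rX) => i; exists (s t * (N t i)^-1) => y.
rewrite (form_adjust omega_gt0 m_lin m_sym hqF (s := s t)) ?formZl // => j.
- by rewrite formZl mulVf ?Nt.
- by move=> y'; exact: contractionP.
- by rewrite formZl mulfVK ?Nt.
Qed.

(* A singular tuple with isotropic entries is moved along x i + (e i / 2) z i,
   with z i isotropic and q (z i) (x i) = 1, so that q (x i) (x i) becomes e i;
   the contractions of the deformed tensor can be prescribed to be lam' i x i
   if lam' i * q (x i) (x i) does not depend on i.  Perturbing the lam i to
   lam i + t makes all of them generically nonzero. *)
Lemma nonisotropic_part_dense : Sigma `<=` closure nonisotropic_part.
Proof.
move=> p Sp; rewrite closureE => Z [cZ UZ].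
have [X pX] := coords_exist p.
pose iso i := q i (X (Some i)) (X (Some i)) == 0.
have [niso|/existsNP[i0 /negP/negbNE iso0]] := pselect (forall i, ~~ iso i).
  by apply: UZ; split=> //; exists X.
pose T := X None; pose x0 i := X (Some i).
have X0 i : x0 i != 0 by exact: coords_neq0 pX.
have /dependent_choice_fun[lam lamP] := (spectral_coordsP pX).1 Sp.
have /dependent_choice_fun[z zP] : forall i, exists z : V i,
    q i z (x0 i) = 1 /\ (iso i -> q i z z = 0).
  move=> i; case: (boolP (iso i)) => [/eqP xx|_].
    by have [z [zx zz]] := form_dual_isotropic (@q_nondeg i) (X0 i) xx; exists z.
  by have [z zx] := form_dual (@q_nondeg i) (X0 i); exists z.
have zx i : q i (z i) (x0 i) = 1 by have [] := zP i.
(* Leaving out the factor of [i] makes [(lam i + t) * e t i] the same for all isotropic entries; the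
   factor [t] makes the curve start at [x0]. *)
pose e t i := t * \prod_(j | iso j && (j != i)) (lam j + t).
pose s t := t * \prod_(j | iso j) (lam j + t).
have se t i : iso i -> s t = (lam i + t) * e t i.
  by move=> ii; rewrite /s (bigD1 i) //= mulrCA.
pose x t i := if iso i then x0 i + (e t i / 2) *: z i else x0 i.
(* Nonisotropic entries stay fixed; their multiple is chosen to give the same pairing [s t]. *)
pose w t i := if iso i then (lam i + t) *: x t i
              else (s t / q i (x0 i) (x0 i)) *: x0 i.
pose v t i := contraction q m qF T (x t) i.
pose c t := s t - qF T (pow_tensor m (x t)).
pose g t := spectral_coords (adjust m T z (v t) (w t) (c t)) (x t).
have zxt t i : q i (z i) (x t i) = 1.
  rewrite /x; case: (boolP (iso i)) => // ii.
  by have [_ zz] := zP i; rewrite !formE zx zz // mulr0 addr0.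
have xxt t i : q i (x t i) (x t i) = if iso i then e t i else q i (x0 i) (x0 i).
  rewrite /x; case: (boolP (iso i)) => // ii; have [_ zz] := zP i.
  rewrite !formE zx (formC (q i) (x0 i)) zx zz // (eqP ii : q i (x0 i) (x0 i) = 0).
  by field.
have wxt t i : q i (w t i) (x t i) = s t.
  rewrite /w; case: (boolP (iso i)) => ii; first by rewrite formZl xxt ii (se t i).
  by rewrite formZl /x (negPf ii) divfK.
set B := [set 0 : R[i]]; have HB := regular_algebra B.
have rlin a : regular B (fun t => a + t).
  by apply: (falg_add HB); [exact: (falg_cst HB)|exact: regular_id].
have re i : regular B (fun t => e t i).
  by apply: (falg_mul HB); [exact: regular_id|exact: (falg_prod HB)].
have rs : regular B s.
  by apply: (falg_mul HB); [exact: regular_id|exact: (falg_prod HB)].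
have rx i : vfun (regular B) (fun t => x t i).
  rewrite /x; case: (iso i); last exact: (vfun_cst HB).
  apply: (vfun_add HB); first exact: (vfun_cst HB).
  apply: (vfun_scale HB); last exact: (vfun_cst HB).
  by apply: (falg_mul HB) => //; exact: (falg_cst HB).
have rw i : vfun (regular B) (fun t => w t i).
  rewrite /w; case: (iso i); apply: (vfun_scale HB) => //; last exact: (vfun_cst HB).
  by apply: (falg_mul HB) => //; exact: (falg_cst HB).
have rT : vfun (regular B) (fun=> T) by exact: (vfun_cst HB).
have rc : regular B c.
  by apply: (falg_sub HB) => //; apply: (vfun_form HB qF rT); exact: vfun_pow_tensor.
have rg o : vfun (regular B) (fun t => g t o).
  apply: vfun_spectral_coords => //; apply: vfun_adjust => // i.
  - exact: (vfun_cst HB).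
  - exact: (@vfun_contraction _ _ HB (fun=> T) x i rT rx).
have e_0 i : e 0 i = 0 by rewrite /e mul0r.
have s_0 : s 0 = 0 by rewrite /s mul0r.
have x_0 : x 0 = x0.
  apply: functional_extensionality_dep => i; rewrite /x e_0 mul0r scale0r addr0.
  by case: (iso i).
(* The isotropic entry [i0] makes this common value zero, so [lam i] is zero at nonisotropic
   entries, in agreement with [w 0]. *)
have Tx i : lam i * q i (x0 i) (x0 i) = qF T (pow_tensor m x0).
  by rewrite -lamP (pow_tensor_repl_id omega_gt0 m x0).
have Tx0 : qF T (pow_tensor m x0) = 0.
  by rewrite -(Tx i0) (eqP iso0 : q i0 (x0 i0) (x0 i0) = 0) mulr0.
have vw : v 0 = w 0.
  apply: functional_extensionality_dep => i; apply: (form_inj (@q_nondeg i)) => y.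
  rewrite contractionP x_0 lamP /w; case: (boolP (iso i)) => ii.
    by rewrite formZl addr0 x_0.
  have := Tx i; rewrite Tx0 => /eqP; rewrite mulf_eq0 -/(iso i) (negPf ii) orbF => /eqP ->.
  by rewrite s_0 !mul0r scale0r form0l.
have g_0 : g 0 = X.
  apply: functional_extensionality_dep => -[i|]; rewrite /g /=; first by rewrite x_0.
  by rewrite vw /c s_0 x_0 Tx0 subrr adjust_id.
apply: (@curve_closed _ _ factor _ B 0 g) => //; first by rewrite g_0.
(* For [t] and all [lam i + t] nonzero, every [e t i] is nonzero, so no entry of the curve is
   isotropic. *)
have gt : generic (fun t : R[i] => t != 0).
  by exists 'X; split=> [|t]; rewrite ?polyX_eq0 // hornerX.
have glam : generic (fun t : R[i] => forall i, lam i + t != 0).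
  apply: generic_forall => i; exists ('X + (lam i)%:P); split.
    by rewrite monic_neq0 // monicXaddC.
  by move=> t; rewrite !hornerE addrC.
apply: generic_imply (generic_and gt glam) => t [t0 lamt] r rX; apply: UZ.
split; last first.
  exists (g t) => // i; rewrite /g /= xxt; case: (boolP (iso i)) => // _.
  by rewrite mulf_neq0 //; apply/prodf_neq0 => j _.
apply/(spectral_coordsP rX) => i.
exists (if iso i then lam i + t else s t / q i (x0 i) (x0 i)) => y.
rewrite (form_adjust omega_gt0 m_lin m_sym hqF (s := s t)) //=; last first.
  by move=> j y'; exact: contractionP.
by rewrite /w /x; case: (iso i); rewrite formZl.
Qed.

End SpectralVariety.

Theorem proposition19 (R : realType) (k : nat) (hk : (0 < k)%N)
  (n omega : 'I_k -> nat)
  (hn : forall i, (0 < n i)%N) (homega : forall i, (0 < omega i)%N)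
  (V : 'I_k -> vectType R[i]) (hV : forall i, \dim {:V i} = n i)
  (q : forall i, {symmetric V i})
  (hq : forall i, complexified_posdef (q i))
  (S : vectType R[i]) (m : sym_args omega V -> S) (hm : is_sym_power m)
  (qF : {symmetric S})
  (hqF : forall x y : forall i, V i,
    qF (pow_tensor m x) (pow_tensor m y) = \prod_i q i (x i) (y i) ^+ omega i) :
  irreducible_set (spectral_variety q m qF) /\
  spectral_variety q m qF =
    closure (spectral_variety q m qF `&`
             spectral_proj (V := V) (S := S) @^-1` (~` isotropic_product q)).
Proof.
have [m_lin m_sym _] := hm.
have q_nondeg i : nondegenerate_form (q i).
  exact: complexified_posdef_nondegenerate.
have q_niso i : exists x, q i x x != 0.
  by apply: complexified_posdef_nonisotropic => //; rewrite hV.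
have dense := nonisotropic_part_dense homega q_nondeg m_lin m_sym hqF.
set A := _ `&` _.
have UA : nonisotropic_part q m qF `<=` A.
  (* As k > 0 there is a first entry, and it is nonisotropic. *)
  move=> p [Sp [X pX Xq]]; split=> // /(_ (Ordinal hk) _ (pX (Some _))) /eqP.
  by rewrite (negPf (Xq _)).
split.
  apply: irreducible_dense dense; last by move=> p [].
  exact: nonisotropic_part_irreducible.
apply/seteqP; split=> [p /dense|]; first exact: closure_subset.
by rewrite closureE => p; apply; split; [exact: spectral_closed|move=> r []].
Qed.
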